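(* Consider any $\omega\in\Omega$ and any $I,J\in\mathcal{C}$. If $I\in\mathcal{C}_{\mathrm{C}}(\omega)$ and $I\subseteq J$, then also $J\in\mathcal{C}_{\mathrm{C}}(\omega)$.
   Context: $\mathbb{N}=\{1,2,\dots\}$, $\mathbb{N}_0=\mathbb{N}\cup\{0\}$. $\mathcal{C}$ is the set of all non-empty closed subintervals of $[0,1]$ (interval forecasts). For $I\in\mathcal{C}$ and $f\colon\{0,1\}\to\mathbb{R}$, $\overline{E}_I(f)=\max_{p\in I}[pf(1)+(1-p)f(0)]$. $\Omega=\{0,1\}^{\mathbb{N}}$ is the set of outcome sequences and $\Omega^\lozenge=\bigcup_{n\in\mathbb{N}_0}\{0,1\}^n$ the set of situations, with $\square$ the empty sequence. For $\omega\in\Omega$, $\omega^n$ is its initial segment of length $n$. A forecasting system is a map $\gamma\colon\Omega^\lozenge\to\mathcal{C}$. A real process is a map $F\colon\Omega^\lozenge\to\mathbb{R}$, with process difference $\Delta F(s)(x)=F(sx)-F(s)$. A supermartingale for $\gamma$ is a real process $M$ with $\overline{E}_{\gamma(s)}(\Delta M(s))\le 0$ for all $s\in\Omega^\lozenge$; a test supermartingale for $\gamma$ is a non-negative supermartingale $T$ for $\gamma$ with $T(\square)=1$. A real process $F$ is computable if there are rational numbers $r_{s,n}=(-1)^{\sigma(s,n)}a(s,n)/b(s,n)$, with $a,b,\sigma\colon\Omega^\lozenge\times\mathbb{N}_0\to\mathbb{N}_0$ computable and $b>0$, and a computable function $e\colon\Omega^\lozenge\times\mathbb{N}_0\to\mathbb{N}_0$,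 such that $n\ge e(s,N)$ implies $|r_{s,n}-F(s)|\le 2^{-N}$ for all $s,n,N$. An outcome sequence $\omega$ is computably random for $\gamma$ if $\sup_{n\in\mathbb{N}}T(\omega^n)<+\infty$ for every computable test supermartingale $T$ for $\gamma$. For $I\in\mathcal{C}$, the stationary forecasting system $\gamma_I$ is given by $\gamma_I(s)=I$ for all $s\in\Omega^\lozenge$, and $\mathcal{C}_{\mathrm{C}}(\omega)=\{I\in\mathcal{C}\colon\omega\text{ is computably random for }\gamma_I\}$. *)

(* Defs.v *)
From HB Require Import structures.
From mathcomp Require Import all_boot all_order all_algebra.
From mathcomp Require Import all_classical all_reals all_analysis.
From mathcomp Require Import ring.

Set Implicit Arguments.
Unset Strict Implicit.
Unset Printing Implicit Defensive.

Import Order.TTheory GRing.Theory Num.Theory.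

Local Open Scope classical_set_scope.
Local Open Scope ring_scope.

Section Computability.
Local Open Scope nat_scope.

(* [murec n]: programs for the n-ary partial recursive functions on nat. *)
Inductive murec : nat -> Type :=
| Zero : murec 0
| Succ : murec 1
| Proj n : 'I_n -> murec n
| Comp n m : murec m -> ('I_m -> murec n) -> murec n
| PrimRec n : murec n -> murec n.+2 -> murec n.+1
| Mu n : murec n.+1 -> murec n.

(* [graph c v y]: the program c halts on the arguments v with value y.
   In [PrimRec f g] the first argument is the recursion variable: the
   sequence h of intermediate values satisfies h 0 = f w and
   h k.+1 = g (k, h k, w).  [Mu f] is unbounded search in the first argument
   and requires f to be defined at all the arguments below the first zero. *)
Fixpoint graph n (c : murec n) : n.-tuple nat -> nat -> Prop :=
  match c in murec n return n.-tuple nat -> nat -> Prop with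
  | Zero => fun _ y => y = 0
  | Succ => fun v y => y = (thead v).+1
  | Proj _ i => fun v y => y = tnth v i
  | Comp _ m f g => fun v y =>
      exists w : m.-tuple nat,
        (forall i, graph (g i) v (tnth w i)) /\ graph f w y
  | PrimRec _ f g => fun v y =>
      let w := behead_tuple v in
      exists h : nat -> nat,
        [/\ graph f w (h 0),
            forall k, k < thead v ->
              graph g (cons_tuple k (cons_tuple (h k) w)) (h k.+1) &
            y = h (thead v)]
  | Mu _ f => fun v y =>
      graph f (cons_tuple y v) 0 /\
      forall k, k < y -> exists z, graph f (cons_tuple k v) z.+1
  end.

Lemma graph_functional n (c : murec n) v y z :
  graph c v y -> graph c v z -> y = z.
Proof.
elim: c v y z => {n} /= [v y z -> ->|v y z -> ->|n i v y z -> ->| | |] //.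
- move=> n m f IHf g IHg v y z [w [gw fw]] [w' [gw' fw']].
  have eqw : w = w' by apply: eq_from_tnth => i; apply: IHg (gw i) (gw' i).
  by rewrite -eqw in fw'; apply: IHf fw fw'.
- move=> n f IHf g IHg v y z [h [h0 hS ->]] [h' [h0' hS' ->]].
  suff H k : k <= thead v -> h k = h' k by apply: H.
  elim: k => [_|k IHk ltk]; first exact: IHf h0 h0'.
  have := hS' k ltk; rewrite -IHk ?(ltnW ltk)// => H.
  exact: IHg (hS k ltk) H.
- move=> n f IHf v y z [fy Hy] [fz Hz].
  case: (ltngtP y z) => // ltyz.
  + by have [u /(IHf _ _ _ fy)] := Hz _ ltyz.
  + by have [u /(IHf _ _ _ fz)] := Hy _ ltyz.
Qed.

End Computability.

(* A situation is the finite sequence of the outcomes observed so far, in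
   chronological order; the outcome 1 is [true] and the outcome 0 is [false]. *)
Definition situation := seq bool.

(* An outcome sequence (w_1, w_2, ...) is indexed from 0: [w i] is w_(i+1). *)
Definition outcome_sequence := nat -> bool.

Definition initial_segment (w : outcome_sequence) (n : nat) : situation :=
  mkseq w n.

(* Effective coding with a decidable range. *)
Definition situation_code (s : situation) : nat :=
  CodeSeq.code [seq nat_of_bool x | x <- s].

Lemma situation_code_inj : injective situation_code.
Proof.
move=> s t /(can_inj CodeSeq.codeK) /inj_map; apply.
by move=> [] [].
Qed.

Definition computable_map (f : situation -> nat -> nat) : Prop :=
  exists c : murec 2, forall s n, graph c [tuple situation_code s; n] (f s n).

Section Forecasting.
Variable R : realType.

Record interval_forecast := IntervalForecast {
  lower_endpoint : R;
  upper_endpoint : R;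
  _ : [&& 0 <= lower_endpoint, lower_endpoint <= upper_endpoint & upper_endpoint <= 1] }.

Definition forecast_set (I : interval_forecast) : set R :=
  `[lower_endpoint I, upper_endpoint I].

Definition expectation (p : R) (f : bool -> R) : R :=
  p * f true + (1 - p) * f false.

(* The supremum is a maximum: see [upper_expectation_max]. *)
Definition upper_expectation (I : interval_forecast) (f : bool -> R) : R :=
  sup [set expectation p f | p in forecast_set I].

Definition forecasting_system := situation -> interval_forecast.

Definition real_process := situation -> R.

Definition process_difference (F : real_process) (s : situation) : bool -> R :=
  fun x => F (rcons s x) - F s.

Definition supermartingale (g : forecasting_system) (M : real_process) : Prop :=
  forall s, upper_expectation (g s) (process_difference M s) <= 0.

Definition test_supermartingale (g : forecasting_system) (T : real_process)
    : Prop :=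
  [/\ supermartingale g T, forall s, 0 <= T s & T [::] = 1].

Definition computable_process (F : real_process) : Prop :=
  exists a b sigma e : situation -> nat -> nat,
    [/\ [/\ computable_map a, computable_map b, computable_map sigma &
            computable_map e],
        forall s n, (0 < b s n)%N &
        forall s n N, (e s N <= n)%N ->
          `|(-1) ^+ sigma s n * (a s n)%:R / (b s n)%:R - F s| <= 2 ^- N].

Definition computably_random (g : forecasting_system) (w : outcome_sequence)
    : Prop :=
  forall T : real_process, computable_process T -> test_supermartingale g T ->
    (ereal_sup [set (T (initial_segment w n))%:E | n in [set n | (0 < n)%N]]
       < +oo)%E.

Definition stationary (I : interval_forecast) : forecasting_system :=
  fun=> I.

Definition computably_random_forecasts (w : outcome_sequence)
    : set interval_forecast :=
  [set I | computably_random (stationary I) w].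

Lemma upper_expectation_max (I : interval_forecast) (f : bool -> R) :
  (exists2 p, forecast_set I p & upper_expectation I f = expectation p f) /\
  (forall p, forecast_set I p -> expectation p f <= upper_expectation I f).
Proof.
have ltI : lower_endpoint I <= upper_endpoint I by case: I => a b /= /and3P[].
have [q Iq qmax] : exists2 q, forecast_set I q &
    forall p, forecast_set I p -> expectation p f <= expectation q f.
  rewrite /forecast_set /expectation; have [le01|lt10] := lerP (f false) (f true).
  - exists (upper_endpoint I); first by rewrite /= in_itv /= ltI lexx.
    move=> p /=; rewrite in_itv /= => /andP[_ lep].
    rewrite -subr_ge0.
    have -> : upper_endpoint I * f true + (1 - upper_endpoint I) * f false -
      (p * f true + (1 - p) * f false) =
      (upper_endpoint I - p) * (f true - f false).
      by ring.
    by rewrite mulr_ge0 // subr_ge0.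
  - exists (lower_endpoint I); first by rewrite /= in_itv /= ltI lexx.
    move=> p /=; rewrite in_itv /= => /andP[lep _].
    rewrite -subr_ge0.
    have -> : lower_endpoint I * f true + (1 - lower_endpoint I) * f false -
      (p * f true + (1 - p) * f false) =
      (p - lower_endpoint I) * (f false - f true).
      by ring.
    by rewrite mulr_ge0 // subr_ge0 // ltW.
have ub : ubound [set expectation p f | p in forecast_set I] (expectation q f).
  by move=> _ [p Ip <-]; apply: qmax.
have Eq : upper_expectation I f = expectation q f.
  apply/eqP; rewrite eq_le; apply/andP; split.
  - by apply: ge_sup => //; exists (expectation q f), q.
  - by apply: ub_le_sup; [exists (expectation q f) | exists q].
by split; [exists q | move=> p /qmax; rewrite Eq].
Qed.

End Forecasting.

(* Main.v *)
Require Import Defs.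
From mathcomp Require Import all_boot all_order all_algebra.
From mathcomp Require Import all_classical all_reals all_analysis.

Local Open Scope classical_set_scope.

(** A larger interval gives a larger upper expectation, so the supermartingale inequality is harder
    to satisfy for [J] than for [I]. Hence every computable test supermartingale for [J] is already
    one for [I], and randomness for [I] bounds it along [omega]. *)

Lemma le_upper_expectation (R : realType) (I J : interval_forecast R)
    (f : bool -> R) :
  forecast_set I `<=` forecast_set J ->
  (upper_expectation I f <= upper_expectation J f)%R.
Proof.
(* The supremum over [I] is attained at some [p], which also competes in the maximum over [J]. *)
move=> subIJ; have [[p Ip ->] _] := upper_expectation_max I f.
by have [_] := upper_expectation_max J f; apply; apply: subIJ.
Qed.

(** The inclusion reverses: wider forecasts admit fewer tests. Only the supermartingale inequality
    involves the forecasts. *)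
Lemma sub_test_supermartingale (R : realType) (g h : forecasting_system R)
    (T : real_process R) :
  (forall s, forecast_set (g s) `<=` forecast_set (h s)) ->
  test_supermartingale h T -> test_supermartingale g T.
Proof.
move=> subgh [hT T_ge0 T1]; split=> // s.
exact: Order.POrderTheory.le_trans (le_upper_expectation _ _ _ _ (subgh s)) (hT s).
Qed.

Theorem proposition10 (R : realType) (omega : outcome_sequence)
    (I J : interval_forecast R) :
  computably_random_forecasts omega I ->
  forecast_set I `<=` forecast_set J ->
  computably_random_forecasts omega J.
Proof.
move=> randI subIJ T compT testT; apply: randI => //.
by apply: sub_test_supermartingale testT => s.
Qed.
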